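(* Let $G$ be an edge-colored graph on $n$ vertices with $e(G)+c(G)=\binom{n}{2}+t_{n,k-2}+1$, where either $k=4$ and $n\geq 8$, or $k=5$ and $n\geq 9$. If $G$ does not contain a rainbow $K_k$, then (1) $G$ is complete, and (2) $G$ contains a rainbow spanning subgraph isomorphic to the Turán graph $T_{n,k-2}$, and all the edges inside the parts of this $T_{n,k-2}$ receive one and the same color, which does not appear on the edges of this $T_{n,k-2}$.
   Context: All graphs are finite, simple and undirected. An edge-colored graph is a graph with an arbitrary (not necessarily proper) coloring of its edges; $e(G)$ is the number of edges and $c(G)$ the number of distinct colors of $G$. A subgraph is rainbow if all its edges have pairwise distinct colors; a rainbow $K_k$ is a rainbow complete subgraph on $k$ vertices. The Turán graph $T_{n,r}$ is the complete $r$-partite graph on $n$ vertices whose part sizes differ by at most one, and $t_{n,r}$ is its number of edges. *)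

(* Defs.v *)
From HB Require Import structures.
From mathcomp Require Import all_boot.
From mathcomp Require Import zify.

Set Implicit Arguments.
Unset Strict Implicit.
Unset Printing Implicit Defensive.

Record sgraph (T : finType) := SGraph {
  adj :> rel T;
  adj_sym : symmetric adj;
  adj_irrefl : irreflexive adj
}.

Definition edges (T : finType) (G : sgraph T) : {set {set T}} :=
  [set [set p.1; p.2] | p : T * T & G p.1 p.2].

Definition is_complete (T : finType) (G : sgraph T) : Prop :=
  forall x y : T, x != y -> G x y.

(* An edge coloring is a total function on vertex sets; only its values on
   edges are ever used. *)
Record ecgraph (T : finType) (C : eqType) := ECGraph {
  graph :> sgraph T;
  col : {set T} -> C
}.

Definition num_edges (T : finType) (G : sgraph T) : nat := #|edges G|.

Definition num_colors (T : finType) (C : eqType) (G : ecgraph T C) : nat :=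
  size (undup [seq col G e | e in edges G]).

(* f embeds H as a (not necessarily induced) subgraph of G whose edges
   f @: e, for e an edge of H, have pairwise distinct colors. *)
Definition rainbow_copy (U T : finType) (C : eqType)
    (H : sgraph U) (G : ecgraph T C) (f : U -> T) : Prop :=
  [/\ injective f,
      forall u v : U, H u v -> G (f u) (f v) &
      {in edges H &, injective (fun e : {set U} => col G (f @: e))}].

Section CompleteMultipartite.
Variables (T : finType) (I : eqType) (part : T -> I).

Let mrel : rel T := fun x y => part x != part y.

Fact mrel_sym : symmetric mrel.
Proof. by move=> x y; rewrite /mrel eq_sym. Qed.

Fact mrel_irrefl : irreflexive mrel.
Proof. by move=> x; rewrite /mrel eqxx. Qed.

Definition multipartite : sgraph T := SGraph mrel_sym mrel_irrefl.

End CompleteMultipartite.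

Fact neq_sym (T : finType) : symmetric (fun x y : T => x != y).
Proof. by move=> x y; rewrite eq_sym. Qed.

Fact neq_irrefl (T : finType) : irreflexive (fun x y : T => x != y).
Proof. by move=> x; rewrite eqxx. Qed.

Definition complete_graph (k : nat) : sgraph 'I_k :=
  SGraph (@neq_sym 'I_k) (@neq_irrefl 'I_k).

Definition has_rainbow_K (T : finType) (C : eqType) (k : nat)
    (G : ecgraph T C) : Prop :=
  exists f : 'I_k -> T, rainbow_copy (complete_graph k) G f.

(* For r > 0 the residues mod r split 'I_n into r parts, whose sizes differ by
   at most one by turan_balanced below. *)
Definition turan_part (n r : nat) (i : 'I_n) : nat := i %% r.

Definition turan (n r : nat) : sgraph 'I_n := multipartite (@turan_part n r).

Definition turan_num (n r : nat) : nat := num_edges (turan n r).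

Lemma card_turan_part (n r a : nat) : a < r ->
  #|[set i : 'I_n | turan_part r i == a]| = n %/ r + (a < n %% r).
Proof.
move=> ar; rewrite -sum1dep_card /turan_part.
rewrite (eq_bigl (fun i : 'I_n => (i : nat) %% r == a)) //.
rewrite big_mkcond /=.
elim: n => [|n IHn]; first by rewrite big_ord0 div0n mod0n.
rewrite big_ord_recr /= {}IHn.
have r0 : 0 < r by lia.
rewrite divnS // modnS.
have := divn_eq n r; have := ltn_pmod n r0.
have -> : (r %| n.+1) = ((n %% r).+1 == r).
  rewrite -addn1 /dvdn -modnDml addn1.
  have := ltn_pmod n r0; rewrite leq_eqVlt => /orP[/eqP ->|h].
    by rewrite modnn !eqxx.
  by rewrite modn_small //; apply/esym; rewrite eqn_leq [r <= _]leqNgt h andbF.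
by move: (n %% r) (n %/ r) => m q; case: (m.+1 =P r); case: (m =P a) => /=; lia.
Qed.

Lemma turan_balanced (n r a b : nat) : a < r -> b < r ->
  #|[set i : 'I_n | turan_part r i == a]| <=
  #|[set i : 'I_n | turan_part r i == b]|.+1.
Proof. by move=> ar br; rewrite !card_turan_part //; lia. Qed.

(* Main.v *)
(* Write r = k - 2, let the weight of a vertex set W be the number of edges plus
   the number of colors inside W, and call 'C(n, 2) + t_(n,r) + 1 the extremal
   weight.  Summing the weights of the sets W minus a vertex counts an edge
   #|W| - 2 times, and a color as often, up to a defect of 1 if its edges in W
   form a star and of 2 if they have no common vertex.  Once all proper subsets
   have at most the extremal weight, a set W of extremal weight or more has
   therefore tiny defect: almost all its colors occur on a single edge.

   A set W above the extremal weight then has (in the few sizes where the count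
   is not already contradictory) large degrees and no color of defect 2, and a
   greedy choice gives a rainbow clique.  For n = 8, r = 2 and n = 9, r = 3, a
   set of extremal weight has no clique on r + 1 vertices made of uniquely
   colored edges, by counting the edges leaving such a clique; so the uniquely
   colored edges form a Turan graph, and one color is left for the rest.  For
   larger n, delete a vertex v whose removal leaves a set of extremal weight.
   If the colors occurring only at v reach all parts of the smaller Turan graph,
   there is a rainbow K_k; otherwise they reach everything but one smallest
   part, which v joins. *)

Require Import Defs.
From HB Require Import structures.
From mathcomp Require Import all_boot.
From mathcomp Require Import zify.

Set Implicit Arguments.
Unset Strict Implicit.
Unset Printing Implicit Defensive.

(** * Edges as two-element vertex sets *)

Lemma pair_set_eq (T : finType) (x y z : T) :
  [set x; y] = [set x; z] -> y = z.
Proof.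
move=> E; have : y \in [set x; z] by rewrite -E !inE eqxx orbT.
have : z \in [set x; y] by rewrite E !inE eqxx orbT.
by rewrite !inE => /orP[] /eqP zE /orP[] /eqP yE; congruence.
Qed.

Lemma in_edges (T : finType) (G : sgraph T) x y :
  ([set x; y] \in edges G) = G x y.
Proof.
apply/imsetP/idP => [[[a b]]|gxy]; last by exists (x, y); rewrite ?inE.
rewrite inE /= => gab E.
have : x \in [set a; b] by rewrite -E !inE eqxx.
rewrite !inE => /orP[]/eqP xE; subst x.
  by move/pair_set_eq: E => ->.
by move: E; rewrite (setUC [set a]) => /pair_set_eq ->; rewrite adj_sym.
Qed.

Lemma adj_neq (T : finType) (G : sgraph T) x y : G x y -> x != y.
Proof. by move=> gxy; apply: contraTneq gxy => ->; rewrite adj_irrefl. Qed.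

Lemma edge_pair (T : finType) (G : sgraph T) e :
  e \in edges G -> exists x y, [/\ G x y, x != y & e = [set x; y]].
Proof.
case/imsetP=> [[x y]]; rewrite inE /= => gxy ->; exists x, y; split=> //.
exact: adj_neq gxy.
Qed.

Lemma card_edge (T : finType) (G : sgraph T) e : e \in edges G -> #|e| = 2.
Proof. by case/edge_pair=> x [y [_ xy ->]]; rewrite cards2 xy. Qed.

Lemma pair_mem (T : finType) (v x y : T) :
  v \in [set x; y] -> exists z, [set x; y] = [set v; z].
Proof.
rewrite !inE => /orP[]/eqP->; first by exists y.
by exists x; rewrite setUC.
Qed.

Lemma edge_at (T : finType) (G : sgraph T) e v :
  e \in edges G -> v \in e -> exists y, G v y /\ e = [set v; y].
Proof.
move=> eE; case/edge_pair: (eE) => x [y [_ _ eq_e]].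
rewrite eq_e => /pair_mem[z ez]; exists z; split=> //.
by rewrite -in_edges -ez -eq_e.
Qed.

(** * Turán numbers *)

Lemma turanS n r : 0 < r ->
  turan_num n.+1 r = turan_num n r + (n - n %/ r).
Proof.
move=> r0; rewrite /turan_num /num_edges.
pose E := edges (turan n.+1 r).
rewrite -[#|edges (turan n.+1 r)|](cardsID [set e : {set 'I_n.+1} | ord_max \in e]) addnC.
congr (_ + _).
  pose w : 'I_n -> 'I_n.+1 := widen_ord (leqnSn n).
  have w_inj : injective w by move=> i j /(congr1 val) /= /val_inj.
  have wE (i : 'I_n.+1) : i != ord_max -> exists j, i = w j.
    move=> im; have ltin : i < n.
      by have := ltn_ord i; rewrite ltnS leq_eqVlt => /orP[/eqP E0|//]; case/eqP: im; apply: val_inj.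
    by exists (Ordinal ltin); apply: val_inj.
  rewrite -(card_imset _ (imset_inj w_inj)); apply: eq_card => e.
  apply/idP/imsetP => [|[e' /edge_pair[i [j [gij _ ->]]] ->]].
    case/setDP=> /edge_pair[i [j [gij _ eE]]]; rewrite inE => me.
    subst e; move: me; rewrite !inE negb_or => /andP[].
    rewrite eq_sym => /wE[i' iE]; rewrite eq_sym => /wE[j' jE].
    exists [set i'; j']; last by rewrite imsetU1 imset_set1 iE jE.
    by rewrite in_edges; move: gij; rewrite iE jE.
  rewrite imsetU1 imset_set1 !inE in_edges; apply/andP; split => //.
  by apply/norP; split; apply/eqP => /(congr1 val) /=; have := ltn_ord i; have := ltn_ord j; lia.
(* The last vertex has index [n], and its residue class holds exactly [n %/ r] of the first [n]
   vertices. *)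
have -> : n - n %/ r = #|[set i : 'I_n | turan_part r i != n %% r]|.
  have := cardsC [set i : 'I_n | turan_part r i == n %% r].
  rewrite card_turan_part ?ltn_pmod // ltnn addn0 card_ord.
  have -> : ~: [set i : 'I_n | turan_part r i == n %% r] = [set i : 'I_n | turan_part r i != n %% r].
    by apply/setP => i; rewrite !inE.
  by lia.
pose g (i : 'I_n) : {set 'I_n.+1} := [set ord_max; widen_ord (leqnSn n) i].
have g_inj : injective g.
  by move=> i j /pair_set_eq /(congr1 val) /= /val_inj.
rewrite -(card_imset _ g_inj); apply: eq_card => e.
apply/idP/imsetP => [|[i]].
  rewrite !inE => /andP[eE me].
  have [j [gmj ->]] := edge_at eE me.
  have jn : j != ord_max by rewrite eq_sym; apply: adj_neq gmj.
  have ltjn : j < n.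
    by have := ltn_ord j; rewrite ltnS leq_eqVlt => /orP[/eqP E0|//]; case/eqP: jn; apply: val_inj.
  exists (Ordinal ltjn); last by congr [set _; _]; apply: val_inj.
  by rewrite inE; move: gmj; rewrite /= /turan_part /= eq_sym.
rewrite inE => gi ->; rewrite !inE eqxx in_edges /= andbT.
by rewrite /turan_part /= eq_sym.
Qed.

Lemma turan0 r : turan_num 0 r = 0.
Proof.
apply/eqP; rewrite cards_eq0; apply/eqP/setP => e; rewrite inE.
by apply/negP => /edge_pair[[]].
Qed.

(** A division-free form of floor(n^2 / 4), suited to [lia] and [nia]; floor(n^2 / 3) is treated
    likewise below. *)
Lemma turan_num2 n : 4 * turan_num n 2 + n %% 2 = n * n.
Proof. by elim: n => [|n IH]; rewrite ?turan0 // turanS //; nia. Qed.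

Lemma turan_num3 n : 3 * turan_num n 3 + (n %% 3 != 0) = n * n.
Proof.
elim: n => [|n IH]; first by rewrite turan0.
have := divn_eq n 3; have := ltn_pmod n (isT : 0 < 3).
have -> : n.+1 %% 3 = (n %% 3 + 1) %% 3 by rewrite modnDml addn1.
rewrite turanS //.
move: IH; move: (n %/ 3) (n %% 3) (turan_num n 3) => q m t IH m3 nE.
move: m m3 IH nE => [|[|[|m]]] //= _ IH nE.
all: by rewrite {}nE in IH *; nia.
Qed.

(** Each chosen vertex discards at most [s] vertices, itself included because [R] is irreflexive, so
    after [j] choices a vertex still remains. *)
Lemma greedy_clique (T : finType) (R : rel T) s j (A : {set T}) :
    symmetric R -> irreflexive R ->
    {in A, forall v, #|[set x in A | ~~ R v x]| <= s} -> s * j < #|A| ->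
  exists K : {set T}, [/\ K \subset A, #|K| = j.+1 &
    {in K &, forall x y, x != y -> R x y}].
Proof.
move=> sR iR; elim: j A => [|j IH] A hs.
  rewrite muln0 => /card_gt0P[v vA]; exists [set v].
  split; [by rewrite sub1set|by rewrite cards1|].
  by move=> x y; rewrite !inE => /eqP-> /eqP->; rewrite eqxx.
move=> hA; have /card_gt0P[v vA] : 0 < #|A| by lia.
pose A' := [set x in A | R v x].
have sA' : A' \subset A by apply/subsetP => x; rewrite !inE => /andP[].
have cA : #|A| <= s + #|A'|.
  rewrite -(cardsID A' A) addnC; apply: leq_add; last first.
    by apply: subset_leq_card; apply: subsetIr.
  apply: leq_trans (hs v vA); apply: subset_leq_card.
  by apply/subsetP => x; rewrite !inE; case: (x \in A) => //=; rewrite andbT.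
have [x xA'||K [sK cK clK]] := IH A'.
- apply: leq_trans (hs x (subsetP sA' x xA')).
  apply: subset_leq_card; apply/subsetP => y; rewrite !inE.
  by move=> /andP[/andP[-> _] ->].
- by move: hA cA; rewrite mulnS; lia.
have Rv x : x \in K -> R v x by move/(subsetP sK); rewrite inE => /andP[].
exists (v |: K); split.
- by rewrite subUset sub1set vA (subset_trans sK).
- rewrite cardsU1 cK; case vK: (v \in K) => //.
  by have := Rv v vK; rewrite iR.
- by move=> x y /setU1P[->|xK] /setU1P[->|yK]; rewrite ?eqxx // ?[R _ v]sR; auto.
Qed.

Lemma clique_rainbow (T : finType) (C : eqType) (G : ecgraph T C) k (K : {set T}) :
    #|K| = k -> {in K &, forall x y, x != y -> G x y} ->
    {in [set e in edges G | e \subset K] &, injective (col G)} ->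
  has_rainbow_K k G.
Proof.
move=> cK clK iK.
pose f (i : 'I_k) : T := enum_val (cast_ord (esym cK) i).
have f_inj : injective f by move=> i j /enum_val_inj /cast_ord_inj.
have fK i : f i \in K by apply: enum_valP.
have fadj (u v : 'I_k) : complete_graph k u v -> G (f u) (f v).
  by move=> uv; apply: clK => //; rewrite (inj_eq f_inj).
exists f; split=> // e e'.
have img (e0 : {set 'I_k}) : e0 \in edges (complete_graph k) ->
    f @: e0 \in [set e1 in edges G | e1 \subset K].
  case/edge_pair=> u [v [uv _ ->]]; rewrite imsetU1 imset_set1 inE in_edges.
  by rewrite fadj // subUset !sub1set !fK.
by move=> he he' /(iK _ _ (img _ he) (img _ he')) /(imset_inj f_inj).
Qed.

(** * Weight and defect of vertex sets *)

Section Weight.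
Variables (T C : finType) (G : ecgraph T C).
Implicit Types (W K : {set T}) (e : {set T}) (c : C).

Definition esub W := [set e in edges G | e \subset W].
Definition csub W := [set col G e | e in esub W].
Definition weight W := #|esub W| + #|csub W|.

(* The common vertices of all the edges of color c inside W. *)
Definition core W c := [set v in W | c \notin csub (W :\ v)].
(** By [card_core] the subtraction never truncates: a term is 2 for edges without a common vertex, 1
    for a star of several edges, 0 for a lone edge. *)
Definition defect W := \sum_(c in csub W) (2 - #|core W c|).

Definition single W e := (e \in esub W) &&
  [forall e' in esub W, (col G e' == col G e) ==> (e' == e)].
(** The graph of uniquely colored edges, which in an extremal set turns out to be the Turán
    graph. *)
Definition link W : rel T := fun x y => single W [set x; y].
Definition deg W v := #|[set x in W | G v x]|.
(** The colors lost when [v] is deleted. A color absent from [W] has all of [W] as its core, hence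
    the restriction to [csub W]. *)
Definition saturated W v := [set c in csub W | v \in core W c].

Lemma esub_pair W x y : ([set x; y] \in esub W) = [&& G x y, x \in W & y \in W].
Proof. by rewrite inE in_edges subUset !sub1set. Qed.

Lemma esub_edge W e : e \in esub W -> e \in edges G.
Proof. by rewrite inE => /andP[]. Qed.

Lemma esub_sub W e : e \in esub W -> e \subset W.
Proof. by rewrite inE => /andP[]. Qed.

Lemma card_esub W e : e \in esub W -> #|e| = 2.
Proof. by move/esub_edge/card_edge. Qed.

Lemma esubS W' W : W' \subset W -> esub W' \subset esub W.
Proof.
move=> sW; apply/subsetP => e; rewrite !inE => /andP[-> /=] h.
exact: subset_trans h sW.
Qed.

Lemma csubS W' W : W' \subset W -> csub W' \subset csub W.
Proof. by move=> sW; apply/imsetS/esubS. Qed.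

Lemma esubD1 W v e : (e \in esub (W :\ v)) = (e \in esub W) && (v \notin e).
Proof. by rewrite !inE subsetD1 andbA. Qed.

Lemma col_csub W e : e \in esub W -> col G e \in csub W.
Proof. exact: imset_f. Qed.

Lemma core_sub_edge W e : e \in esub W -> core W (col G e) \subset e.
Proof.
move=> eW; apply/subsetP => v; rewrite inE => /andP[vW].
by apply: contraR => ve; apply: col_csub; rewrite esubD1 eW.
Qed.

Lemma card_core W c : c \in csub W -> #|core W c| <= 2.
Proof.
by case/imsetP=> e eW ->; rewrite -(card_esub eW) subset_leq_card ?core_sub_edge.
Qed.

(** Every edge of the color contains the core, so a core of two vertices equals each such edge. *)
Lemma core2_single W e : e \in esub W -> #|core W (col G e)| = 2 -> single W e.
Proof.
move=> eW c2; rewrite /single eW; apply/forall_inP => e' e'W; apply/implyP => /eqP ce.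
have coreE e0 : e0 \in esub W -> col G e0 = col G e -> core W (col G e) = e0.
  move=> e0W ce0; apply/eqP.
  by rewrite eqEcard c2 (card_esub e0W) leqnn -ce0 core_sub_edge.
by rewrite -(coreE e' e'W ce) -{2}(coreE e).
Qed.

Lemma single_esub W e : single W e -> e \in esub W.
Proof. by case/andP. Qed.

Lemma singleP W e e' :
  single W e -> e' \in esub W -> col G e' = col G e -> e' = e.
Proof. by move=> /andP[_ /forall_inP sg] /sg /implyP h /eqP/h/eqP. Qed.

Lemma single_core W e : single W e -> e \subset core W (col G e).
Proof.
move=> sg; have eW := single_esub sg; apply/subsetP => v ve.
rewrite inE (subsetP (esub_sub eW)) //; apply/imsetP => -[e'].
rewrite esubD1 => /andP[e'W ve'] /esym ce.
by rewrite (singleP sg e'W ce) ve in ve'.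
Qed.

Lemma singleS K W e : K \subset W -> e \in esub K -> single W e -> single K e.
Proof.
move=> sK eK sg; rewrite /single eK; apply/forall_inP => e' e'K.
apply/implyP => /eqP ce; apply/eqP; apply: singleP sg _ ce.
by apply: subsetP (esubS sK) _ _.
Qed.

Lemma link_sym W : symmetric (link W).
Proof. by move=> x y; rewrite /link setUC. Qed.

Lemma link_adj W x y : link W x y -> [/\ G x y, x \in W & y \in W].
Proof. by move/single_esub; rewrite esub_pair => /and3P[]. Qed.

Lemma link_irrefl W : irreflexive (link W).
Proof. by move=> x; apply/negP => /link_adj[]; rewrite adj_irrefl. Qed.

(** One exceptional edge [e0] can be tolerated: the other edges share their colors with nothing in
    [K], hence not with [e0] either. *)
Lemma rainbow_of_single k (K : {set T}) e0 :
    #|K| = k -> {in K &, forall x y, x != y -> G x y} ->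
    (forall e, e \in esub K -> e != e0 -> single K e) ->
  has_rainbow_K k G.
Proof.
move=> cK clK sg; apply: clique_rainbow cK clK _ => e e' eK e'K ce.
case: (eqVneq e e0) => [ee0|/(sg e eK) se].
  case: (eqVneq e' e0) => [->//|/(sg e' e'K) se'].
  exact: singleP se' eK ce.
by apply/esym/(singleP se e'K).
Qed.

Lemma card_esub_at W v (P : pred {set T}) :
  #|[set e in esub W | (v \in e) && P e]| <= #|[set x in W | G v x && P [set v; x]]|.
Proof.
apply: leq_trans (leq_imset_card (fun x => [set v; x]) _).
apply: subset_leq_card; apply/subsetP => e; rewrite inE => /and3P[eW ve Pe].
have [x [gvx eE]] := edge_at (esub_edge eW) ve; apply/imsetP; exists x => //.
rewrite eE in eW Pe; move: eW; rewrite esub_pair => /and3P[_ _ xW].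
by rewrite inE xW gvx.
Qed.

Lemma weightD1 W v : v \in W ->
  weight W <= weight (W :\ v) + deg W v + #|saturated W v|.
Proof.
move=> vW; rewrite /weight -addnA addnACA; apply: leq_add.
  rewrite -(cardsID [set e : {set T} | v \in e]) addnC leq_add //.
    apply: subset_leq_card; apply/subsetP => e; rewrite esubD1 !in_setD.
    by rewrite [_ \in [set _ | _]]inE andbC.
  have -> : deg W v = #|[set x in W | G v x && predT [set v; x]]|.
    by apply: eq_card => z; rewrite !inE andbT.
  by apply: leq_trans (card_esub_at W v predT); apply: subset_leq_card; apply/subsetP => e; rewrite !inE andbT.
rewrite -(cardsID (csub (W :\ v))) leq_add ?subset_leq_card ?subsetIr //.
by apply/subsetP => c; rewrite !inE vW andbC.
Qed.

(** A color lost with [v] has an edge at [v], and distinct colors yield distinct edges. *)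
Lemma saturated_le W v (P : pred {set T}) :
    (forall e, e \in esub W -> v \in core W (col G e) -> P e) ->
  #|saturated W v| <= #|[set x in W | G v x && P [set v; x]]|.
Proof.
move=> hP; apply: leq_trans (card_esub_at W v P).
apply: leq_trans (leq_imset_card (col G) _); apply: subset_leq_card.
apply/subsetP => c; rewrite inE => /andP[/imsetP[e eW ->] ve].
by apply: imset_f; rewrite inE eW hP // (subsetP (core_sub_edge eW)).
Qed.

Lemma saturated_le_deg W v : #|saturated W v| <= deg W v.
Proof.
apply: leq_trans (saturated_le (P := predT) _) _ => //.
by apply: subset_leq_card; apply/subsetP => x; rewrite !inE andbT.
Qed.

(** An edge is lost in two of the vertex deletions, a color in as many as its core has vertices; its
    shortfall from two is its share of the defect. Adding [2 * weight W] avoids subtraction. *)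
Lemma sum_weight W :
  \sum_(v in W) weight (W :\ v) + 2 * weight W = #|W| * weight W + defect W.
Proof.
have sumE : \sum_(v in W) #|esub (W :\ v)| + 2 * #|esub W| = #|W| * #|esub W|.
  have -> : 2 * #|esub W| = \sum_(v in W) #|[set e in esub W | v \in e]|.
    transitivity (\sum_(e in esub W) \sum_(v in W | v \in e) 1).
      rewrite -sum1_card big_distrr /=; apply: eq_bigr => e eW.
      rewrite sum1dep_card muln1 -(card_esub eW); apply: eq_card => v; rewrite !inE.
      by apply/idP/andP => [ve|[]//]; rewrite ve (subsetP (esub_sub eW)).
    rewrite (exchange_big_dep (mem W)) //=; last by move=> ? ? _ /andP[].
    by apply: eq_bigr => v vW; rewrite sum1dep_card; apply: eq_card => e; rewrite !inE vW.
  rewrite -big_split /= -sum_nat_const; apply: eq_bigr => v _.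
  rewrite -(cardsID [set e : {set T} | v \in e] (esub W)) addnC; congr (_ + _).
    by apply: eq_card => e; rewrite !inE.
  by apply: eq_card => e; rewrite esubD1 !inE andbC.
have sumC : \sum_(v in W) #|csub (W :\ v)| + 2 * #|csub W| = #|W| * #|csub W| + defect W.
  have -> : 2 * #|csub W| = \sum_(v in W) #|saturated W v| + defect W.
    transitivity (\sum_(c in csub W) #|core W c| + defect W).
      rewrite -sum1_card big_distrr -big_split /=; apply: eq_bigr => c /card_core; lia.
    congr (_ + _).
    transitivity (\sum_(c in csub W) \sum_(v in W | v \in core W c) 1).
      apply: eq_bigr => c _; rewrite sum1dep_card; apply: eq_card => v; rewrite !inE.
      by case: (v \in W).
    rewrite (exchange_big_dep (mem W)) //=; last by move=> ? ? _ /andP[].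
    by apply: eq_bigr => v vW; rewrite sum1dep_card; apply: eq_card => c; rewrite !inE vW.
  rewrite addnA -big_split /= -sum_nat_const; congr (_ + _); apply: eq_bigr => v vW.
  rewrite -(cardsID (csub (W :\ v)) (csub W)); congr (_ + _).
    by congr #|pred_of_set _|; apply/esym/setIidPr/csubS/subD1set.
  by apply: eq_card => c; rewrite !inE vW andbC.
by rewrite /weight big_split /= !mulnDr -sumE addnACA sumC addnA.
Qed.

End Weight.

(** * Extremal weight and averaging *)

Definition extremal_weight n r := 'C(n, 2) + turan_num n r + 1.

Lemma extremal_weightS n r : 0 < r ->
  extremal_weight n.+1 r = extremal_weight n r + n + (n - n %/ r).
Proof. by move=> r0; rewrite /extremal_weight turanS // binS bin1; lia. Qed.

(* Averaging over the vertex-deleted subgraphs: the identity sum_weight forces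
   the defect to be small. *)
Lemma defect_le (T C : finType) (G : ecgraph T C) (W : {set T}) n r a b :
    0 < r -> 0 < n -> #|W| = n.+1 ->
    {in W, forall v, weight G (W :\ v) + a <= extremal_weight n r} ->
    extremal_weight n.+1 r + b <= weight G W ->
  defect G W + n.+1 * a + n.-1 * (b + (n - n %/ r)) <= 2 * turan_num n r + 2.
Proof.
move=> r0 n0 cW ub lb.
have le_sum : \sum_(v in W) weight G (W :\ v) + n.+1 * a <= n.+1 * extremal_weight n r.
  rewrite -cW -!sum_nat_const -big_split /=; exact: leq_sum.
have := sum_weight G W; rewrite cW.
have c2 : 2 * 'C(n, 2) = n * n.-1.
    rewrite mul2n bin2 halfK oddM; case: (n) => //= n'.
    by rewrite andNb subn0.
move: lb le_sum; rewrite extremal_weightS //.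
move: (\sum_(v in W) _) (weight G W) (defect G W) (n - n %/ r) => S w D d.
rewrite /extremal_weight; move: (turan_num n r) 'C(n, 2) c2 => t c.
move=> c2 lb le_sum eq_sum.
(* In [sum_weight] the weight of [W] is left with the coefficient [#|W| - 2], which is [n.-1]. *)
have := leq_mul (leqnn n.-1) lb.
by case: n n0 {cW ub lb} c2 le_sum eq_sum => [//|n] _ /=; rewrite !mulnDr ?mulSn ?mulnS; lia.
Qed.

(** Quotient and remainder make the later inequalities polynomial, with only two or three remainders
    to try. *)
Lemma turan_cases r n : r = 2 \/ r = 3 ->
  exists q m, [/\ m < r, n = q * r + m, n - n %/ r = q * r + m - q &
    (r = 2 /\ turan_num n r = q * q + q * m) \/
    (r = 3 /\ turan_num n r = 3 * q * q + 2 * q * m + (m == 2))].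
Proof.
move=> hr; exists (n %/ r), (n %% r).
have r0 : 0 < r by lia.
split; rewrite ?ltn_pmod -?divn_eq //.
have nE := divn_eq n r; have mr := ltn_pmod n r0.
case: hr nE mr => -> nE mr; [left|right]; split=> //.
  have := turan_num2 n; move: (n %/ 2) (n %% 2) (turan_num n 2) nE mr => q m t.
  by case: m => [|[|m]] // nE _; rewrite nE; nia.
have := turan_num3 n; move: (n %/ 3) (n %% 3) (turan_num n 3) nE mr => q m t.
by case: m => [|[|[|m]]] //= nE _; rewrite nE; nia.
Qed.

(** A surplus over the extremal weight survives averaging only for quotients up to 3. In those sizes
    [s] bounds the non-neighbors of a vertex, itself included, and is small enough for a greedy
    choice of [r + 2] vertices. *)
Lemma supercritical_arith r n D b : r = 2 \/ r = 3 -> r < n -> 0 < b ->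
    D + n.-1 * (b + (n - n %/ r)) <= 2 * turan_num n r + 2 ->
  exists s, [/\ D <= 1, s * r.+1 + D < n.+1 &
    forall d, n + (n - n %/ r) + 1 <= 2 * d -> n.+1 <= d + s].
Proof.
move=> hr rn b0 hD; have [q [m [mr nE dE tE]]] := turan_cases n hr.
rewrite {}dE in hD *.
have {b b0}hD : D + n.-1 * (1 + (q * r + m - q)) <= 2 * turan_num n r + 2 by nia.
subst n.
case: tE hD => -[rE ->]; subst r => hD.
- have q3 : q <= 3 by clear hr; move: m mr hD rn => [|[|m]] //; nia.
  move: q q3 m mr rn hD => [|[|[|[|q]]]] // _ [|[|m]] //= _ _ hD;
  (by exists 1; split; [lia|lia|move=> d; lia]) || (by exists 2; split; [lia|lia|move=> d; lia]).
- have q3 : q <= 3 by clear hr; move: m mr hD rn => [|[|[|m]]] //=; nia.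
  move: q q3 m mr rn hD => [|[|[|[|q]]]] // _ [|[|[|m]]] //= _ _ hD;
  (by exists 1; split; [lia|lia|move=> d; lia]) || (by exists 2; split; [lia|lia|move=> d; lia]).
Qed.

(** * Cliques of uniquely colored edges and the upper bound on the weight *)

Section Clique.
Variables (T C : finType) (G : ecgraph T C).
Implicit Types (W K : {set T}).

Lemma card_nonadj W v : #|[set x in W | ~~ G v x]| + deg G W v = #|W|.
Proof.
rewrite addnC -(cardsID [set x | G v x] W).
by congr (_ + _); apply: eq_card => x; rewrite !inE 1?andbC.
Qed.

Lemma sum_core1 W :
  #|[set c in csub G W | #|core G W c| == 1]| <= defect G W.
Proof.
rewrite -sum1dep_card big_mkcondr; apply: leq_sum => c _.
by case: eqP => [->|].
Qed.

Lemma core0_defect W c :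
  c \in csub G W -> #|core G W c| = 0 -> 
  defect G W = 2 + \sum_(c' in csub G W | c' != c) (2 - #|core G W c'|).
Proof. by move=> cW c0; rewrite /defect (bigD1 c) //= c0. Qed.

(* The greedy choice avoids the centers of the color classes that are stars with
   at least two edges. *)
Lemma star_clique W s j :
    {in csub G W, forall c, 0 < #|core G W c|} ->
    {in W, forall v, #|W| <= deg G W v + s} -> s * j + defect G W < #|W| ->
  exists K, [/\ K \subset W, #|K| = j.+1,
    {in K &, forall x y, x != y -> link G W x y} &
    {in K, forall v, forall c, c \in csub G W -> v \in core G W c ->
       #|core G W c| = 2}].
Proof.
move=> core_gt0 degW ltW.
pose P := [set core G W c | c in [set c in csub G W | #|core G W c| == 1]].
pose A := W :\: cover P.
have cardP : #|cover P| <= defect G W.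
  apply: leq_trans (leq_card_cover P).1 _.
  have -> : \sum_(X in P) #|X| = #|P|.
    rewrite -sum1_card; apply: eq_bigr => X /imsetP[c].
    by rewrite inE => /andP[_ /eqP c1] ->.
  exact: leq_trans (leq_imset_card _ _) (sum_core1 W).
have inP c v : c \in csub G W -> v \in core G W c -> #|core G W c| = 1 ->
    v \in cover P.
  move=> cW vc c1; apply/bigcupP; exists (core G W c) => //.
  by apply: imset_f; rewrite inE cW c1.
have core2 v c : v \in A -> c \in csub G W -> v \in core G W c -> #|core G W c| = 2.
  move=> /setDP[_ vP] cW vc; have := card_core cW.
  have := core_gt0 c cW; case E: #|core G W c| => [|[|[|//]]] // _ _.
  by rewrite (inP c v cW vc E) in vP.
(* The nonempty core of the color lies in the edge, so it contains [x] or [y]; neither is the center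
   of a larger star, so the core has two vertices. *)
have adjA x y : x \in A -> y \in A -> G x y -> link G W x y.
  move=> xA yA gxy; have xyW : [set x; y] \in esub G W.
    by rewrite esub_pair gxy; case/setDP: xA => ->; case/setDP: yA => ->.
  have cW := col_csub xyW.
  have /card_gt0P[z zc] := core_gt0 _ cW.
  apply: core2_single => //.
  have := subsetP (core_sub_edge xyW) z zc; rewrite !inE => /orP[]/eqP zE; subst z.
    exact: (core2 x).
  exact: (core2 y).
have [||v vA||K [sK cK clK]] := @greedy_clique T (link G W) s j A.
- exact: link_sym.
- exact: link_irrefl.
- have vW : v \in W by case/setDP: vA.
  have := degW v vW; rewrite -(card_nonadj W v) addnC leq_add2l.
  apply: leq_trans; apply: subset_leq_card; apply/subsetP => x.
  rewrite inE [in X in _ -> X]inE => /andP[xA].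
  by case/setDP: (xA) => -> _; apply: contra; apply: adjA.
- rewrite /A cardsD; have := subset_leq_card (subsetIr W (cover P)).
  by move: cardP ltW; lia.
exists K; split=> //; first by apply: subset_trans sK _; apply: subsetDl.
by move=> v vK c; apply: core2; apply: (subsetP sK).
Qed.

Lemma esub_clique W K e : {in K &, forall x y, x != y -> link G W x y} ->
  e \in esub G K -> single G W e.
Proof.
move=> clK eK; have [x [y [_ xy eE]]] := edge_pair (esub_edge eK); subst e.
by move: eK; rewrite esub_pair => /and3P[_ xK yK]; apply: clK.
Qed.

Lemma link_clique_rainbow W K k : K \subset W -> #|K| = k ->
  {in K &, forall x y, x != y -> link G W x y} -> has_rainbow_K k G.
Proof.
move=> sK cK clK; apply: (@rainbow_of_single T C G k K set0) => //.
  by move=> x y xK yK xy; case: (link_adj (clK x y xK yK xy)).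
by move=> e eK _; apply: singleS sK eK (esub_clique clK eK).
Qed.

Lemma weight_le_deg W v : v \in W -> weight G W <= weight G (W :\ v) + 2 * deg G W v.
Proof. by move=> /(weightD1 G); have := saturated_le_deg G W v; lia. Qed.

Lemma weight_le_bin W : weight G W <= 2 * 'C(#|W|, 2).
Proof.
have le_e : #|esub G W| <= 'C(#|W|, 2).
  rewrite -cards_draws; apply: subset_leq_card; apply/subsetP => e eW.
  by rewrite inE (esub_sub eW) (card_esub eW).
rewrite /weight mul2n -addnn leq_add //.
exact: leq_trans (leq_imset_card _ _) le_e.
Qed.

(** In a smallest counterexample all vertex-deleted subsets obey the bound, so averaging leaves a
    defect of at most 1: no core is empty, and the degrees are large enough for [star_clique] to
    find [r + 2] linked vertices. *)
Lemma weight_le r W : r = 2 \/ r = 3 -> ~ has_rainbow_K r.+2 G ->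
  weight G W <= extremal_weight #|W| r.
Proof.
move=> hr hK; have r0 : 0 < r by lia.
have [n cW] := ubnP #|W|; elim: n W cW => // n IH W; rewrite ltnS => cW.
case: (ltnP r.+1 #|W|) => [rW|Wr]; last first.
  (* Up to [r + 1] vertices, even a complete graph with all colors distinct respects the bound, with
     equality at [r + 1], where the Turán graph lacks one edge. *)
  apply: leq_trans (weight_le_bin W) _; rewrite /extremal_weight.
  move: Wr; case: hr => -> {cW}; case: #|W| => [|[|[|[|[|m]]]]] // _.
  - by rewrite (_ : 'C(2, 2) = 1) //; have := turan_num2 2; rewrite [_ %% _]/=; lia.
  - by rewrite (_ : 'C(3, 2) = 3) //; have := turan_num2 3; rewrite [_ %% _]/=; lia.
  - by rewrite (_ : 'C(2, 2) = 1) //; have := turan_num3 2; rewrite [(_ != _)]/=; lia.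
  - by rewrite (_ : 'C(3, 2) = 3) //; have := turan_num3 3; rewrite [(_ != _)]/=; lia.
  - by rewrite (_ : 'C(4, 2) = 6) //; have := turan_num3 4; rewrite [(_ != _)]/=; lia.
rewrite leqNgt; apply/negP => gtW.
have [N WN] : exists N, #|W| = N.+1 by exists #|W|.-1; lia.
have cD v : v \in W -> #|W :\ v| = N by move=> vW; have := cardsD1 v W; rewrite vW; lia.
have ubD v : v \in W -> weight G (W :\ v) <= extremal_weight N r.
  by move=> vW; rewrite -(cD v vW); apply: IH; rewrite cD //; lia.
have dW : defect G W + N.-1 * (1 + (N - N %/ r)) <= 2 * turan_num N r + 2.
  have := @defect_le T C G W N r 0 1 r0 _ WN; rewrite muln0 addn0; apply; first by lia.
    by move=> v vW; rewrite addn0 ubD.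
  by rewrite addn1 -WN.
have rN : r < N by lia.
have [s [D1 ltD degS]] := supercritical_arith hr rN (isT : 0 < 1) dW.
have [c cW0|v vW||K [sK cK clK _]] := @star_clique W s r.+1.
- rewrite lt0n; apply/eqP => c0.
  by have := core0_defect cW0 c0; lia.
- rewrite WN; apply: degS.
  have := weight_le_deg vW; have := ubD v vW; move: gtW; rewrite WN extremal_weightS //; lia.
- by rewrite WN.
by apply: hK; apply: link_clique_rainbow sK cK clK.
Qed.

End Clique.

(** * Balanced partitions from clique-free relations *)

Lemma turan_partition (T : finType) (R : rel T) (W : {set T}) r q :
    symmetric R -> irreflexive R -> 1 < r -> 0 < q -> #|W| = r * q ->
    {in W, forall v, #|[set x in W | ~~ R v x]| <= q} ->
    (forall K : {set T}, K \subset W -> #|K| = r.+1 ->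
       ~ {in K &, forall x y, x != y -> R x y}) ->
  exists part : T -> nat, [/\ {in W, forall x, part x < r},
    forall a, a < r -> #|[set x in W | part x == a]| = q &
    {in W &, forall x y, (part x == part y) = ~~ R x y}].
Proof.
move=> sR iR r1 qgt0 cW hq noK; pose M v := [set x in W | ~~ R v x].
have MW v : M v \subset W by apply/subsetP => x; rewrite inE => /andP[].
have vM v : v \in W -> v \in M v by move=> vW; rewrite inE vW iR.
(* Take a clique [K] of [r - 1] vertices related to [v]. The set [I] of vertices related to all of
   [K] is independent, as a related pair would extend [K] to a forbidden clique. It contains [v], so
   it lies in [M v], and counting shows that it fills [M v]. *)
have MI v : v \in W -> #|M v| = q /\ {in M v &, forall x y, ~~ R x y}.
  move=> vW; have hqv := hq v vW.
  have cN : #|W :\: M v| >= r * q - q.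
    by rewrite cardsD (setIidPr (MW v)) cW leq_sub2l.
  (* The argument [r.-2] yields [r - 1] vertices, since [greedy_clique] returns one more. *)
  have [x /setDP[xW _]||K [sK cK clK]] := @greedy_clique T R q r.-2 (W :\: M v) sR iR.
  - apply: leq_trans (hq x xW); apply: subset_leq_card; apply/subsetP => y.
    by rewrite !inE => /andP[/andP[_ ->] ->].
  - by move: cN; case: r r1 {cW noK} => [|[|r]] // _; nia.
  have sKW : K \subset W by apply: subset_trans sK (subsetDl _ _).
  pose I := [set x in W | [forall y in K, R x y]].
  have indI : {in I &, forall x y, ~~ R x y}.
    move=> x y; rewrite !inE => /andP[xW /forall_inP xK] /andP[yW /forall_inP yK].
    apply/negP => Rxy; apply: (noK (x |: (y |: K))).
    - by rewrite !subUset !sub1set xW yW.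
    - have xNK : x \notin y |: K.
        rewrite !inE negb_or; apply/andP; split.
          by apply: contraTneq Rxy => ->; rewrite iR.
        by apply/negP => /xK; rewrite iR.
      have yNK : y \notin K by apply/negP => /yK; rewrite iR.
      by rewrite !cardsU1 xNK yNK cK; lia.
    - have Rx z : z \in y |: K -> R x z by case/setU1P=> [->//|/xK].
      have cl2 : {in y |: K &, forall a b, a != b -> R a b}.
        by move=> a b /setU1P[->|aK] /setU1P[->|bK]; rewrite ?eqxx // ?[R _ y]sR; auto.
      by move=> a b /setU1P[->|aK] /setU1P[->|bK]; rewrite ?eqxx // ?[R _ x]sR; auto.
  have vI : v \in I.
    rewrite inE vW; apply/forall_inP => y /(subsetP sK).
    by rewrite !inE => /andP[h yW]; move: h; rewrite yW negbK.
  have sIM : I \subset M v.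
    by apply/subsetP => x xI; rewrite inE indI // andbT; move: xI; rewrite inE => /andP[].
  (* A vertex outside [I] is unrelated to some member of [K], and the members of [K] account for at
     most [(r - 1) * q] such vertices. *)
  have cI : q <= #|I|.
    have sub : W :\: I \subset \bigcup_(y in K) M y.
      apply/subsetP => x /setDP[xW]; rewrite inE xW /= negb_forall_in.
      by case/exists_inP=> y yK Rxy; apply/bigcupP; exists y; rewrite // inE xW sR.
    have : #|\bigcup_(y in K) M y| <= r.-1 * q.
      have -> : r.-1 * q = \sum_(y in K) q by rewrite sum_nat_const cK; case: (r) r1 => [|[]].
      elim/big_rec2: _ => [|y m A yK h]; first by rewrite cards0.
      apply: leq_trans (leq_card_setU _ _).1 (leq_add (hq y _) h).
      exact: (subsetP sKW).
    have := subset_leq_card sub; rewrite cardsD cW.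
    have := subset_leq_card (subsetIr W I).
    by case: (r) r1 => // r' _; rewrite mulSn; lia.
  have MvI : I = M v by apply/eqP; rewrite eqEcard sIM (leq_trans hqv).
  split; last by rewrite -MvI.
  by apply/eqP; rewrite eqn_leq hqv -MvI.
have Meq x y : x \in W -> y \in W -> (M x == M y) = ~~ R x y.
  move=> xW yW; apply/eqP/idP => [E|nR].
    by have := vM y yW; rewrite -E inE => /andP[].
  have [cx ix] := MI x xW; have [cy iy] := MI y yW.
  apply/eqP; rewrite eqEcard cx cy leqnn andbT; apply/subsetP => z zx.
  have zW := subsetP (MW x) z zx; rewrite inE zW; apply: ix zx.
  by rewrite inE yW.
(* The parts are the distinct sets [M v]; their common size [q] forces exactly [r] of them. *)
pose Q := M @: W.
have fib A : A \in Q -> #|[set x in W | M x == A]| = q.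
  case/imsetP=> v vW ->; have [<- _] := MI v vW; apply: eq_card => x.
  by rewrite !inE; case xW: (x \in W) => //=; rewrite Meq // sR.
have cQ : #|Q| = r.
  have : \sum_(A in Q) #|[set x in W | M x == A]| = r * q.
    rewrite -cW -[RHS]sum1_card (partition_big M (mem Q)) /=; last first.
      by move=> x xW; apply: imset_f.
    by apply: eq_bigr => A _; rewrite sum1dep_card.
  rewrite (eq_bigr (fun=> q)) // sum_nat_const.
  by move/eqP; rewrite eqn_pmul2r // => /eqP.
exists (fun x => index (M x) (enum Q)); split.
- by move=> x xW; rewrite -cQ cardE index_mem mem_enum; apply: imset_f.
- move=> a ar; have aQ : nth set0 (enum Q) a \in Q.
    by rewrite -mem_enum mem_nth // -cardE cQ.
  rewrite -(fib _ aQ); apply: eq_card => x; rewrite !inE.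
  case xW: (x \in W) => //=; have MQ : M x \in enum Q by rewrite mem_enum imset_f.
  apply/eqP/eqP => [<-|->]; first by rewrite nth_index.
  by rewrite index_uniq ?enum_uniq // -cardE cQ.
- move=> x y xW yW; rewrite -Meq //; apply/eqP/eqP => [|-> //].
  by move/(congr1 (nth set0 (enum Q))); rewrite !nth_index ?mem_enum ?imset_f.
Qed.

(** * Extremal sets of the smallest sizes *)

Section Base.
Variables (T C : finType) (G : ecgraph T C).
Implicit Types (W K : {set T}).

(** Part sizes follow the labels exactly as for the residue classes of [turan_part]. Being linked
    makes the edges between parts rainbow and keeps their colors off all other edges of [W]. *)
Definition turan_coloring W r (part : T -> nat) (c0 : C) : Prop :=
  [/\ {in W, forall x, part x < r},
      forall a, a < r ->
        #|[set x in W | part x == a]| = #|W| %/ r + (a < #|W| %% r),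
      {in W &, forall x y, x != y -> part x = part y ->
        G x y /\ col G [set x; y] = c0} &
      {in W &, forall x y, part x != part y ->
        link G W x y /\ col G [set x; y] != c0}].

Lemma saturated_le_link W v :
    {in csub G W, forall c, v \in core G W c -> #|core G W c| = 2} ->
  #|saturated G W v| <= #|[set x in W | link G W v x]|.
Proof.
move=> core2; apply: leq_trans (saturated_le (P := single G W) _) _.
  by move=> e eW vc; apply: core2_single => //; apply: core2 => //; apply: col_csub.
by apply: subset_leq_card; apply/subsetP => x; rewrite !inE => /and3P[-> _].
Qed.

(* Every vertex x sends to K at most r.+1 edges, of which at most r.-1 are of
   unique color unless one edge is missing: weight at most 2 * r in total. *)
Lemma link_clique_bound W K r :
    ~ has_rainbow_K r.+2 G -> K \subset W -> #|K| = r.+1 ->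
    {in K &, forall x y, x != y -> link G W x y} ->
  \sum_(v in K) (deg G W v + #|[set x in W | link G W v x]|) <= #|W| * (2 * r).
Proof.
move=> hK sK cK clK.
have KW x : x \in K -> x \in W by apply: (subsetP sK).
have ->: \sum_(v in K) (deg G W v + #|[set x in W | link G W v x]|) =
   \sum_(x in W) (#|[set v in K | G v x]| + #|[set v in K | link G W v x]|).
  have swap (R : rel T) :
    \sum_(v in K) #|[set x in W | R v x]| = \sum_(x in W) #|[set v in K | R v x]|.
    under eq_bigr do rewrite -sum1dep_card.
    rewrite (exchange_big_dep (mem W)) //=; last by move=> ? ? _ /andP[].
    by apply: eq_bigr => x xW; rewrite sum1dep_card; apply: eq_card => v; rewrite !inE xW.
  by rewrite !big_split /= (swap (link G W)) -(swap G).
rewrite -sum_nat_const; apply: leq_sum => x xW.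
set L := [set v in K | link G W v x]; set D := [set v in K | G v x].
have sLD : L \subset D.
  by apply/subsetP => v; rewrite !inE => /andP[-> /link_adj[]].
have sDK : D \subset K by apply/subsetP => v; rewrite inE => /andP[].
have LD := subset_leq_card sLD; have DK := subset_leq_card sDK.
(* A vertex of [K] has at most [r] neighbors in [K], hence at most [r] links. *)
case xK: (x \in K).
  have : D \subset K :\ x.
    apply/subsetP => v vD; rewrite !inE (subsetP sDK v vD) andbT.
    by move: vD; rewrite inE => /andP[_]; apply: adj_neq.
  by move/subset_leq_card; have := cardsD1 x K; rewrite xK cK; lia.
(* More than [2 * r] forces [x] to be adjacent to all of [K] and linked to all but at most one
   vertex [v0], so [x |: K] is a clique with at most one exceptional edge. *)
rewrite leqNgt; apply/negP => gt2r; apply: hK.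
have DeK : D = K by apply/eqP; rewrite eqEcard sDK cK; lia.
have Kx v : v \in K -> G v x by rewrite -DeK inE => /andP[].
have [v0 hv0] : exists v0, forall v, v \in K -> v != v0 -> link G W v x.
  have cKL : #|K :\: L| <= 1.
    rewrite cardsD (setIidPr (subset_trans sLD sDK)); rewrite cK in DK *; lia.
  case: (set_0Vmem (K :\: L)) => [KL0|[v0 v0KL]].
    (* Nothing is exceptional here, and [x] serves as a dummy for [v0]. *)
    exists x => v vK _; have : v \notin K :\: L by rewrite KL0 inE.
    by rewrite !inE vK andbT negbK => /andP[].
  exists v0 => v vK; apply: contraNT => nl; apply/eqP.
  apply: (card_le1_eqP cKL) => //.
  by rewrite !inE vK /= andbT.
apply: (@rainbow_of_single T C G r.+2 (x |: K) [set v0; x]).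
- by rewrite cardsU1 xK cK.
- move=> a b /setU1P[->|aK] /setU1P[->|bK] ab; rewrite ?eqxx // in ab *.
  + by rewrite adj_sym Kx.
  + exact: Kx.
  + by case: (link_adj (clK a b aK bK ab)).
- have sxK : x |: K \subset W by rewrite subUset sub1set xW.
  move=> e eK' ne; apply: (singleS sxK eK').
  have [xe|xe] := boolP (x \in e).
    have [b [gxb eE]] := edge_at (esub_edge eK') xe; subst e; rewrite setUC in ne eK' *.
    have bK : b \in K.
      move: eK'; rewrite esub_pair => /and3P[_ /setU1P[bx|//] _].
      by rewrite bx adj_irrefl in gxb.
    by apply: hv0 => //; apply: contraNneq ne => ->.
  apply: (esub_clique clK); rewrite inE (esub_edge eK') /=; apply/subsetP => z ze.
  have := subsetP (esub_sub eK') z ze; rewrite !inE => /orP[/eqP zx|//].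
  by rewrite -zx ze in xe.
Qed.

(** Averaging gives defect at most 2. If every core were nonempty, [star_clique] would give [r + 1]
    linked vertices, which degree counting excludes. So one color [c0] takes the whole defect, all
    others are uniquely used, and [turan_partition] applies to [link]. *)
Lemma turan_coloring_base r W :
    (r = 2 /\ #|W| = 8) \/ (r = 3 /\ #|W| = 9) ->
    ~ has_rainbow_K r.+2 G -> extremal_weight #|W| r <= weight G W ->
  exists part c0, turan_coloring W r part c0.
Proof.
move=> hrW hK ltW.
have hr : r = 2 \/ r = 3 by lia.
have [N WN] : exists N, #|W| = N.+1 by exists #|W|.-1; lia.
have hrN : (r = 2 /\ N = 7) \/ (r = 3 /\ N = 8) by lia.
have ubD v : v \in W -> weight G (W :\ v) <= extremal_weight N r.
  move=> vW; have -> : N = #|W :\ v| by have := cardsD1 v W; rewrite vW; lia.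
  exact: weight_le.
have lbW : extremal_weight N r + N + (N - N %/ r) <= weight G W.
  by rewrite -extremal_weightS -?WN //; lia.
have D2 : defect G W <= 2.
  have := @defect_le T C G W N r 0 0 _ _ WN; rewrite muln0 !addn0 -WN.
  move=> /(_ _ _ _ ltW) h.
  have {}h : defect G W + N.-1 * (N - N %/ r) <= 2 * turan_num N r + 2.
    by apply: h; [lia|lia|move=> v vW; rewrite addn0 ubD].
  (* The two cases read [defect G W + 24 <= 26] and [defect G W + 42 <= 44]. *)
  case: hrN h => -[-> ->].
    by have := turan_num2 7; rewrite [_ %% _]/= [_ %/ _]/=; lia.
  by have := turan_num3 8; rewrite [(_ != _)]/= [_ %/ _]/=; lia.
have dW v : v \in W -> N + (N - N %/ r) <= deg G W v + #|saturated G W v|.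
  by move=> vW; have := weightD1 G vW; have := ubD v vW; lia.
have noK K : K \subset W -> #|K| = r.+1 ->
    {in K &, forall x y, x != y -> link G W x y} ->
    ~ {in K, forall v, forall c, c \in csub G W -> v \in core G W c ->
       #|core G W c| = 2}.
  move=> sK cK clK core2; have := link_clique_bound hK sK cK clK.
  apply/negP; rewrite -ltnNge.
  (* The contradiction is 3 * 11 > 8 * 4 for [r = 2] and 4 * 14 > 9 * 6 for [r = 3]. *)
  apply: (@leq_trans (\sum_(v in K) (N + (N - N %/ r)))).
    rewrite sum_nat_const cK.
    by case: hrN WN => -[-> ->] ->; rewrite [_ %/ _]/=.
  apply: leq_sum => v vK; have := dW v (subsetP sK v vK).
  have := @saturated_le_link W v (core2 v vK); lia.
have [c0 c0W core0] : exists2 c, c \in csub G W & #|core G W c| = 0.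
  case: (pickP [pred c in csub G W | #|core G W c| == 0]) => [c /andP[cW /eqP c0]|no0].
    by exists c.
  have [c cW|v vW||K [sK cK clK core2]] := @star_clique T C G W 2 r.
  - by rewrite lt0n; have := no0 c; rewrite /= cW /= => ->.
  - have := dW v vW; have := saturated_le_deg G W v; rewrite WN.
    by case: hrN => -[-> ->]; rewrite [_ %/ _]/=; lia.
  - lia.
  by case: (noK K sK cK clK).
(* The color [c0] already contributes 2 to the defect, leaving nothing for the others. *)
have core2 c : c \in csub G W -> c != c0 -> #|core G W c| = 2.
  move=> cW cc0; have := core0_defect c0W core0; rewrite (bigD1 c) ?cW //=.
  by have := card_core cW; lia.
have core2v v c : c \in csub G W -> v \in core G W c -> #|core G W c| = 2.
  move=> cW vc; apply: core2 => //; apply: contraTneq vc => ->.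
  by rewrite (cards0_eq core0) inE.
have degN v : v \in W -> deg G W v <= N.
  move=> vW; have := card_nonadj G W v; rewrite WN.
  have : 0 < #|[set x in W | ~~ G v x]|.
    by apply/card_gt0P; exists v; rewrite inE vW adj_irrefl.
  lia.
have qE : exists q, [/\ 0 < q, #|W| = r * q & q + (N - N %/ r) = #|W|].
  by case: hrW hrN => -[-> ->] [[//] _ -> | [//] _ ->]; [exists 4|exists 3].
have [q [q0 cW qN]] := qE; have r1 : 1 < r by lia.
have hlink v : v \in W -> N - N %/ r <= #|[set x in W | link G W v x]|.
  move=> vW; have := dW v vW; have := degN v vW.
  by have := @saturated_le_link W v (core2v v); lia.
have cardC v : #|[set x in W | ~~ link G W v x]| + #|[set x in W | link G W v x]| = #|W|.
  rewrite addnC -(cardsID [set x | link G W v x] W).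
  by congr (_ + _); apply: eq_card => x; rewrite !inE 1?andbC.
have [v vW|K sK cK clK|part [part_lt part_card part_eq]] :=
    turan_partition (@link_sym _ _ G W) (@link_irrefl _ _ G W) r1 q0 cW.
- by have := cardC v; have := hlink v vW; lia.
- by apply: (noK K) => // v _; apply: core2v.
exists part, c0; split=> //.
- by move=> a ar; rewrite part_card // cW mulKn ?modnMr ?addn0 //; lia.
- move=> x y xW yW xy pxy.
  have nl : ~~ link G W x y by rewrite -part_eq // pxy.
  have cx : #|[set z in W | ~~ link G W x z]| = q.
    rewrite -(part_card _ (part_lt x xW)); apply: eq_card => z; rewrite !inE.
    by case zW: (z \in W) => //=; rewrite -part_eq // eq_sym.
  (* A missing edge at [x] would have to be made up by one more link, but [x] has exactly [q]
     unlinked vertices. *)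
  have gxy : G x y.
    apply/negP => ngxy.
    have : [set x; y] \subset [set z in W | ~~ G x z].
      by rewrite subUset !sub1set !inE xW yW adj_irrefl; apply/negP.
    move/subset_leq_card; rewrite cards2 xy.
    have := card_nonadj G W x; have := cardC x; have := dW x xW.
    by have := @saturated_le_link W x (core2v x); lia.
  split=> //; apply/eqP; apply: contraNT nl => cxy.
  have eW : [set x; y] \in esub G W by rewrite esub_pair gxy xW.
  by apply: core2_single => //; apply: core2 => //; apply: col_csub.
- move=> x y xW yW; rewrite part_eq // negbK => lxy; split=> //.
  apply/eqP => cE; have : x \in core G W (col G [set x; y]).
    by apply: subsetP (single_core lxy) _ _; rewrite !inE eqxx.
  by rewrite cE (cards0_eq core0) inE.
Qed.

End Base.

(** * Adding a vertex to a Turán coloring *)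

Section Step.
Variables (T C : finType) (G : ecgraph T C).
Implicit Types (U S K : {set T}).

Lemma linkI K x y : [set x; y] \in esub G K ->
    (forall e, e \in esub G K -> col G e = col G [set x; y] -> e = [set x; y]) ->
  link G K x y.
Proof.
move=> xyK sg; rewrite /link /single xyK; apply/forall_inP => e eK.
by apply/implyP => /eqP ce; apply/eqP; apply: sg.
Qed.

Lemma esub_split U K v e : K \subset v |: U -> e \in esub G K ->
  (exists y, [/\ G v y, y \in K & e = [set v; y]]) \/ (v \notin e /\ e \in esub G U).
Proof.
move=> sK eK; have [ve|ve] := boolP (v \in e); [left|right].
  have [y [gvy eE]] := edge_at (esub_edge eK) ve; exists y; split=> //.
  by move: eK; rewrite eE esub_pair => /and3P[].
split=> //; rewrite inE (esub_edge eK) /=; apply/subsetP => z ze.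
have /(subsetP sK) := subsetP (esub_sub eK) z ze.
by case/setU1P=> // zv; rewrite -zv ze in ve.
Qed.

(** One representative per part, a second one [s'] in part [a0], and [v] form the clique. Its only
    pair inside a part is the exceptional edge of [rainbow_of_single]; colors at [v] need be unique
    only within the clique. *)
Lemma hub_rainbow U r part c0 v (s : 'I_r -> T) (s' : T) (a0 : 'I_r) :
    turan_coloring G U r part c0 -> v \notin U ->
    (forall a, s a \in U /\ part (s a) = a) ->
    s' \in U -> part s' = a0 -> s' != s a0 ->
    (forall y, y \in s' |: [set s a | a : 'I_r] ->
       link G (v |: (s' |: [set s a | a : 'I_r])) v y) ->
  has_rainbow_K r.+2 G.
Proof.
move=> [_ _ same_part diff_part] vU sP s'U ps' s'a0.
set S := s' |: _; set K := v |: S => linkK.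
have sS : S \subset U.
  apply/subsetP => x /setU1P[->//|/imsetP[a _ ->]].
  by case: (sP a).
have sK : K \subset v |: U by apply: setUS.
have s_inj : injective s.
  by move=> a b sab; apply: val_inj; rewrite /= -(sP a).2 -(sP b).2 sab.
have s'nS : s' \notin [set s a | a : 'I_r].
  apply/negP => /imsetP[a _ s'E]; move: ps' s'a0; rewrite s'E (sP a).2.
  by move=> /val_inj ->; rewrite eqxx.
have same_pair x y : x \in S -> y \in S -> x != y -> part x = part y ->
    [set x; y] = [set s a0; s'].
  move=> /setU1P[->|/imsetP[a _ ->]] /setU1P[->|/imsetP[b _ ->]].
  - by rewrite eqxx.
  - by rewrite ps' (sP b).2 => _ /val_inj <-; rewrite setUC.
  - by rewrite ps' (sP a).2 => _ /val_inj ->.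
  - by rewrite (sP a).2 (sP b).2 => + /val_inj ab; rewrite ab eqxx.
apply: (@rainbow_of_single T C G r.+2 K [set s a0; s']).
- rewrite /K cardsU1 (contra (subsetP sS v)) // /S cardsU1 s'nS.
  by rewrite card_imset // card_ord.
- move=> x y /setU1P[->|xS] /setU1P[->|yS]; rewrite ?eqxx //= => xy.
  + by case/link_adj: (linkK y yS).
  + by rewrite adj_sym; case/link_adj: (linkK x xS).
  + have [xU yU] := (subsetP sS x xS, subsetP sS y yS).
    have [pxy|pxy] := eqVneq (part x) (part y).
      by case: (same_part x y xU yU xy pxy).
    by case: (diff_part x y xU yU pxy) => /link_adj[].
- move=> e eK ne; case: (esub_split sK eK) => [[y [gvy yK eE]]|[ve eU]].
    subst e; apply: linkK; case/setU1P: yK => // yv.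
    by rewrite yv adj_irrefl in gvy.
  have [x [y [_ xy eE]]] := edge_pair (esub_edge eK); subst e.
  have inS z : z \in [set x; y] -> z \in S.
    move=> ze; have := subsetP (esub_sub eK) z ze.
    by case/setU1P=> // zv; rewrite -zv ze in ve.
  have [xS yS] : x \in S /\ y \in S by split; apply: inS; rewrite !inE eqxx ?orbT.
  have [xU yU] := (subsetP sS x xS, subsetP sS y yS).
  have [pxy|pxy] := eqVneq (part x) (part y).
    by rewrite (same_pair x y) ?eqxx in ne.
  have [lxy _] := diff_part x y xU yU pxy.
  (* A repetition at [v] contradicts uniqueness there; one inside [U] contradicts [lxy]. *)
  apply: linkI => // e' e'K ce.
  case: (esub_split sK e'K) => [[z [gvz zK e'E]]|[_ e'U]].
    subst e'; have zS : z \in S.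
      by case/setU1P: zK => // zv; rewrite zv adj_irrefl in gvz.
    by have := singleP (linkK z zS) eK (esym ce) => eq_e; rewrite eq_e !inE eqxx in ve.
  exact: singleP lxy e'U ce.
Qed.

(* One edge at v for each of the colors that occur in v |: U but not in U. *)
Lemma new_color_reps U v : v \notin U ->
  exists S, [/\ S \subset U, #|S| = #|saturated G (v |: U) v|,
    {in S, forall y, G v y /\ col G [set v; y] \notin csub G U} &
    {in S &, injective (fun y => col G [set v; y])}].
Proof.
move=> vU; set W := v |: U; have WU : W :\ v = U by rewrite setU1K.
have /fin_all_exists[y yP] (c : C) : exists y : T, c \in saturated G W v ->
    [/\ y \in U, G v y, col G [set v; y] = c & c \notin csub G U].
  case cS: (c \in saturated G W v); last by exists v.
  move: cS; rewrite inE => /andP[/imsetP[e eW ->] vc].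
  have ve := subsetP (core_sub_edge eW) v vc.
  have [y [gvy eE]] := edge_at (esub_edge eW) ve; exists y => _.
  split=> //; last by move: vc; rewrite inE WU => /andP[].
    move: eW; rewrite eE esub_pair => /and3P[_ _ /setU1P[yv|//]].
    by rewrite yv adj_irrefl in gvy.
  by rewrite eE.
exists (y @: saturated G W v); split.
- by apply/subsetP => x /imsetP[c /yP[yU _ _ _] ->].
- by apply: card_in_imset => c c' /yP[_ _ cE _] /yP[_ _ cE' _] yy; rewrite -cE yy.
- by move=> x /imsetP[c /yP[_ g cE nc] ->]; rewrite cE.
- move=> x x' /imsetP[c /yP[_ _ cE _] ->] /imsetP[c' /yP[_ _ cE' _] ->].
  by rewrite cE cE' => ->.
Qed.

(** The set [S] collects one neighbor of [v] per new color. Since [v] has degree at most [n], [S]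
    has at least [n - n %/ r] vertices, so it can miss only one part, and only a smallest one. *)
Lemma turan_coloring_step r U part c0 v :
    1 < r -> 2 < #|U| %/ r -> r < #|U| - #|U| %/ r ->
    ~ has_rainbow_K r.+2 G -> turan_coloring G U r part c0 -> v \notin U ->
    #|U| + (#|U| - #|U| %/ r) <= deg G (v |: U) v + #|saturated G (v |: U) v| ->
  exists part', turan_coloring G (v |: U) r part' c0.
Proof.
move=> r1 n2 rn hK TU vU ltdeg; have r0 : 0 < r by lia.
have [part_lt part_card same_part diff_part] := TU.
have [S [sSU cS newS injS]] := new_color_reps vU.
set W := v |: U in ltdeg cS *; set n := #|U| in n2 rn part_card ltdeg.
have sUW : U \subset W by apply: subsetUr.
have col_new y e : y \in S -> e \in esub G U -> col G e <> col G [set v; y].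
  by move=> yS eU ce; case: (newS y yS) => _; rewrite -ce col_csub.
have degW : deg G W v + #|[set x in W | ~~ G v x] :\ v| = n.
  have := card_nonadj G W v; rewrite (cardsD1 v [set _ in _ | _]) cardsU1 vU.
  by rewrite inE setU11 adj_irrefl /=; rewrite -/n; lia.
(* If [S] met every part, its more than [r] vertices would contain representatives and a further
   vertex, all joined to [v] by distinct new colors. *)
have [b [br Sb]] : exists b, b < r /\ forall y, y \in S -> part y != b.
  have [/forallP allS|] := boolP [forall a : 'I_r, exists y in S, part y == a].
    have /fin_all_exists[s sP] (a : 'I_r) : exists y : T, y \in S /\ part y = a.
      by have /exists_inP[y yS /eqP] := allS a; exists y.
    have [x xS xs] : exists2 x, x \in S & x \notin [set s a | a : 'I_r].
      apply/subsetPn; apply/negP => /subset_leq_card/leq_trans/(_ (leq_imset_card _ _)).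
      by rewrite card_ord cS; move: degW ltdeg; lia.
    case: hK; have xU := subsetP sSU x xS.
    apply: (@hub_rainbow U r part c0 v s x (Ordinal (part_lt x xU))) => //.
    - by move=> a; case: (sP a) => /(subsetP sSU).
    - by apply: contraNneq xs => ->; apply: imset_f.
    set S' := x |: _ => y yS'.
    have sS' : S' \subset S.
      by apply/subsetP => z /setU1P[->//|/imsetP[a _ ->]]; case: (sP a).
    have yS := subsetP sS' y yS'.
    apply: linkI; first by rewrite esub_pair (newS y yS).1 setU11 setU1r.
    move=> e eK ce; have sKW : v |: S' \subset W by apply: setUS (subset_trans sS' sSU).
    case: (esub_split sKW eK) => [[z [gvz zK eE]]|[_ /(col_new y)]]; last first.
      by move=> /(_ yS).
    subst e; have zS : z \in S.
      by case/setU1P: zK => [zv|/(subsetP sS')//]; rewrite zv adj_irrefl in gvz.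
    by rewrite (injS z y zS yS ce).
  rewrite negb_forall => /existsP[b /exists_inP Sb]; exists b; split=> // y yS.
  by apply/negP => pb; apply: Sb; exists y.
pose X := [set x in U | part x == b].
have sXU : X \subset U by apply/subsetP => x; rewrite inE => /andP[].
have cX := part_card b br; rewrite -/X in cX.
have sSX : S \subset U :\: X.
  apply/subsetP => y yS; rewrite !inE (subsetP sSU y yS) /= andbT.
  exact: Sb.
have cUX : #|U :\: X| = n - #|X| by rewrite cardsD (setIidPr sXU).
have lSX := subset_leq_card sSX.
have bm : n %% r <= b.
  rewrite leqNgt; apply/negP => bm; rewrite bm in cX.
  by move: rn; lia.
have {}cX : #|X| = n %/ r by rewrite cX ltnNge bm addn0.
(* The counts are now tight: [S] is everything outside part [b], and [v] has full degree. *)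
have SE : S = U :\: X by apply/eqP; rewrite eqEcard sSX cUX cX cS; lia.
have adjv y : y \in U -> G v y.
  move=> yU; apply/negPn/negP => ngy.
  have : y \in [set x in W | ~~ G v x] :\ v.
    by rewrite !inE ngy yU orbT !andbT; apply: contraNneq vU => <-.
  by move=> yN; have := cardsD1 y ([set x in W | ~~ G v x] :\ v); rewrite yN; lia.
have inSX y : y \in U -> part y != b -> y \in S.
  by move=> yU py; rewrite SE !inE yU /= andbT.
(* With any other color on this edge, a hub using [x] for part [b] and vertices of [S] elsewhere
   would be rainbow. *)
have colX x : x \in X -> col G [set v; x] = c0.
  move=> xX; apply/eqP/negPn/negP => cx; have xU := subsetP sXU x xX.
  have px : part x = b by move: xX; rewrite inE => /andP[_ /eqP].
  pose Y := v |: (x |: S).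
  have sYW : Y \subset W by apply: setUS; rewrite subUset sub1set xU.
  (* At most one further edge of [Y] has this color: new colors are distinct on [S], and a color
     other than [c0] occurs at most once inside [U]. That edge has an end [t] in [S], which the hub
     will avoid. *)
  have [t [tS tP]] : exists t, t \in S /\ forall e, e \in esub G Y ->
      col G e = col G [set v; x] -> e != [set v; x] -> t \in e.
    case: (pickP [pred e in esub G Y |
        (col G e == col G [set v; x]) && (e != [set v; x])]) => [e|noe]; last first.
      have /card_gt0P[t tS] : 0 < #|S| by rewrite SE cUX cX; lia.
      exists t; split=> // e eY ce ne.
      by have := noe e; rewrite /= eY ce eqxx ne.
    case/and3P=> eY /eqP ce ne.
    case: (esub_split sYW eY) => [[y [gvy yY eE]]|[ve eU]].
      have yS : y \in S.
        case/setU1P: yY => [yv|/setU1P[yx|//]]; first by rewrite yv adj_irrefl in gvy.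
        by rewrite eE yx eqxx in ne.
      exists y; split=> // e' e'Y ce' ne'.
      case: (esub_split sYW e'Y) => [[z [gvz zY e'E]]|[_ e'U]]; last first.
        by case: (col_new y e' yS e'U); rewrite ce' -ce eE.
      have zS : z \in S.
        case/setU1P: zY => [zv|/setU1P[zx|//]]; first by rewrite zv adj_irrefl in gvz.
        by rewrite e'E zx eqxx in ne'.
      rewrite e'E (injS z y zS yS) ?inE ?eqxx ?orbT //=.
      by rewrite -e'E -eE ce ce'.
    have [p [q [gpq pq eE]]] := edge_pair (esub_edge eY).
    move: (eU); rewrite eE esub_pair => /and3P[_ pU qU].
    have ppq : part p != part q.
      apply: contraNneq cx => ppq; rewrite -ce eE.
      by case: (same_part p q pU qU pq ppq) => _ ->.
    have [lpq _] := diff_part p q pU qU ppq; rewrite /link -eE in lpq.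
    have [t [tS te]] : exists t, t \in S /\ t \in e.
      have [pb|pb] := eqVneq (part p) b.
        by exists q; split; [apply: inSX; rewrite // -pb eq_sym|rewrite eE !inE eqxx orbT].
      by exists p; split; [apply: inSX|rewrite eE !inE eqxx].
    exists t; split=> // e' e'Y ce' ne'.
    case: (esub_split sYW e'Y) => [[z [gvz zY e'E]]|[_ e'U]].
      have zS : z \in S.
        case/setU1P: zY => [zv|/setU1P[zx|//]]; first by rewrite zv adj_irrefl in gvz.
        by rewrite e'E zx eqxx in ne'.
      by case: (col_new z e zS eU); rewrite ce -ce' e'E.
    by rewrite (singleP lpq e'U _) // ce ce'.
  (* Parts have at least three vertices, so two can be avoided. *)
  have pick_avoid a (y0 : T) : a < r ->
      exists y, [/\ y \in U, part y = a, y != t & y != y0].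
    move=> ar; have : 0 < #|[set z in U | part z == a] :\ t :\ y0|.
      have := part_card a ar.
      have := cardsD1 t [set z in U | part z == a].
      have := cardsD1 y0 ([set z in U | part z == a] :\ t).
      by move: n2; lia.
    case/card_gt0P=> y; rewrite !inE => /and4P[yy0 yt yU /eqP pya].
    by exists y.
  have /fin_all_exists[s sP] (a : 'I_r) : exists y, [/\ y \in U, part y = a, y != t &
      part y = b -> y = x].
    have [ab|ab] := eqVneq (a : nat) b.
      exists x; split=> //; first by rewrite px.
      by apply: contraTneq xX => ->; move: tS; rewrite SE => /setDP[].
    have [y [yU py yt _]] := pick_avoid a x (ltn_ord a); exists y; split=> //.
    by rewrite py => ab'; rewrite ab' eqxx in ab.
  (* The doubled part is not [b], so [x] remains the only vertex of the hub taken from [X]. *)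
  have [a0 a0b] : exists a0 : 'I_r, (a0 : nat) != b.
    have [b0|b0] := eqVneq b 0; last by exists (Ordinal r0); rewrite eq_sym.
    by exists (Ordinal r1); rewrite b0.
  have [s' [s'U ps' s't s's]] := pick_avoid a0 (s a0) (ltn_ord a0).
  apply: hK; apply: (@hub_rainbow U r part c0 v s s' a0) => //.
    by move=> a; case: (sP a).
  set S' := s' |: _.
  have S'P z : z \in S' -> z != t /\ (z = x \/ z \in S).
    case/setU1P=> [->|/imsetP[a _ ->]].
      by split=> //; right; apply: inSX; rewrite // ps'.
    have [saU psa sat sab] := sP a; split=> //.
    have [pb|pb] := eqVneq (part (s a)) b; first by left; apply: sab.
    by right; apply: inSX.
  have sKY : v |: S' \subset Y.
    apply/setUS/subsetP => z /S'P[_ [->|zS]]; first exact: setU11.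
    exact: setU1r.
  have tK : t \notin v |: S'.
    apply/negP => /setU1P[tv|/S'P[]]; last by rewrite eqxx.
    by move: vU; rewrite -tv (subsetP sSU).
  move=> y yS'; have [yt yxS] := S'P y yS'.
  have yU : y \in U by case: yxS => [-> //|/(subsetP sSU)].
  have vyK : [set v; y] \in esub G (v |: S').
    by rewrite esub_pair adjv // setU11 setU1r.
  have avoid e : e \in esub G (v |: S') -> col G e = col G [set v; x] -> e = [set v; x].
    move=> eK ce; apply/eqP/negPn/negP => ne.
    have te := tP e (subsetP (esubS G sKY) e eK) ce ne.
    by rewrite (subsetP (esub_sub eK) t te) in tK.
  apply: linkI => // e eK ce.
  case: yxS => [yx|yS]; first by rewrite yx; apply: avoid; rewrite // ce yx.
  case: (esub_split (subset_trans sKY sYW) eK) => [[z [gvz zK eE]]|[_ eU]]; last first.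
    by case: (col_new y e yS eU).
  have /S'P[_ [zx|zS]] : z \in S'.
    by case/setU1P: zK => // zv; rewrite zv adj_irrefl in gvz.
    have vyE : [set v; y] = [set v; x] by apply: avoid; rewrite // -ce eE zx.
    by rewrite eE zx vyE.
  by rewrite eE (injS z y zS yS) // -eE.
(* Two vertices of [X] show that [c0] is an old color, so it differs from the new ones. *)
have c0U : c0 \in csub G U.
  have : 1 < #|X| by rewrite cX; lia.
  case/card_gt1P=> x [y [xX yX xy]]; have [xU yU] := (subsetP sXU x xX, subsetP sXU y yX).
  have pxy : part x = part y.
    by move: xX yX; rewrite !inE => /andP[_ /eqP->] /andP[_ /eqP->].
  have [gxy <-] := same_part x y xU yU xy pxy.
  by apply: col_csub; rewrite esub_pair gxy xU.
have linkS y : y \in S -> link G W v y /\ col G [set v; y] != c0.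
  move=> yS; have yU := subsetP sSU y yS; split; last first.
    by apply: contraNneq (newS y yS).2 => ->.
  apply: linkI => [|e eW ce]; first by rewrite esub_pair adjv // setU11 setU1r.
  case: (esub_split (subxx _) eW) => [[z [gvz zW eE]]|[_ eU]]; last first.
    by case: (col_new y e yS eU).
  have zU : z \in U by case/setU1P: zW => // zv; rewrite zv adj_irrefl in gvz.
  have zS : z \in S.
    apply: inSX => //; apply: contraNneq (newS y yS).2 => pz.
    by rewrite -ce eE colX // inE zU pz eqxx.
  by rewrite eE (injS z y zS yS) // -eE.
(* The part that grows must carry label [m] for the sizes to match the residue pattern. Parts [b]
   and [m] both have size [n %/ r], so their labels can be exchanged. *)
pose m := n %% r; have mr : m < r by apply: ltn_pmod.
pose swap i := if i == b then m else if i == m then b else i.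
have swapK : involutive swap.
  by move=> i; rewrite /swap; do !case: ifP => //; lia.
have swap_lt i : i < r -> swap i < r.
  by move=> ir; rewrite /swap; do !case: ifP.
pose part1 x := if x == v then b else part x.
have part1v : part1 v = b by rewrite /part1 eqxx.
have part1U x : x \in U -> part1 x = part x.
  by rewrite /part1; case: eqP => // -> /(negP vU).
exists (swap \o part1); split.
- move=> x /setU1P[->|xU] /=; apply: swap_lt; first by rewrite part1v.
  by rewrite part1U // part_lt.
- move=> a ar.
  have -> : [set x in W | (swap \o part1) x == a] =
      [set x in [set v] | b == swap a] :|: [set x in U | part x == swap a].
    apply/setP => x; rewrite !inE /= -(inj_eq (inv_inj swapK)) swapK.
    case: (x =P v) => [->|xv] /=; first by rewrite part1v (negbTE vU) orbF.
    by case xU: (x \in U) => //=; rewrite part1U.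
  rewrite cardsU (_ : _ :&: _ = set0) ?cards0 ?subn0; last first.
    apply/setP => x; rewrite !inE; case: (x =P v) => [->|//].
    by rewrite (negbTE vU) andbF.
  have -> : #|[set x in [set v] | b == swap a]| = (b == swap a).
    case: (b == swap a).
      by rewrite -[RHS](cards1 v); apply: eq_card => x; rewrite !inE andbT.
    by apply/eqP; rewrite cards_eq0; apply/eqP/setP => x; rewrite !inE andbF.
  rewrite part_card ?swap_lt // cardsU1 vU -/n add1n.
  rewrite divnS // modnS.
  have -> : (r %| n.+1) = (m.+1 == r).
    rewrite /dvdn -addn1 -modnDml addn1 -/m.
    case: (ltngtP m.+1 r) => [lt||->]; rewrite ?modnn //; last by lia.
    by rewrite modn_small.
  rewrite -/m; clear -mr bm ar; rewrite /swap.
  case: (a =P b); case: (a =P m); case: (m.+1 =P r); rewrite -/m in bm; lia.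
- move=> x y /setU1P[->|xU] /setU1P[->|yU]; rewrite ?eqxx //= => xy /(inv_inj swapK).
  + rewrite part1v part1U // => /esym py; rewrite adjv //; split=> //.
    by apply: colX; rewrite inE yU py eqxx.
  + rewrite part1v part1U // => px; rewrite adj_sym adjv //; split=> //.
    by rewrite setUC; apply: colX; rewrite inE xU px eqxx.
  + by rewrite !part1U //; apply: same_part.
- move=> x y /setU1P[->|xU] /setU1P[->|yU]; rewrite ?eqxx //= (inj_eq (inv_inj swapK)).
  + by rewrite part1v part1U // eq_sym => py; apply/linkS/inSX.
  + by rewrite part1v part1U // link_sym setUC => py; apply/linkS/inSX.
  + rewrite !part1U // => pxy; have [lxy cxy] := diff_part x y xU yU pxy.
    split=> //; have xyU := single_esub lxy.
    apply: linkI => [|e eW ce]; first exact: subsetP (esubS G sUW) _ xyU.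
    case: (esub_split (subxx _) eW) => [[z [gvz zW eE]]|[_ eU]]; last first.
      exact: singleP lxy eU ce.
    have zU : z \in U by case/setU1P: zW => // zv; rewrite zv adj_irrefl in gvz.
    have [pz|pz] := eqVneq (part z) b.
      by move: cxy; rewrite -ce eE colX ?eqxx // inE zU pz eqxx.
    by case: (col_new z [set x; y] (inSX z zU pz) xyU); rewrite -ce eE.
Qed.

End Step.

(** * Induction on the number of vertices *)

Lemma turan_coloring_exists (T C : finType) (G : ecgraph T C) (W : {set T}) r :
    (r = 2 /\ 8 <= #|W|) \/ (r = 3 /\ 9 <= #|W|) ->
    ~ has_rainbow_K r.+2 G -> extremal_weight #|W| r <= weight G W ->
  exists part c0, turan_coloring G W r part c0.
Proof.
have [n] := ubnP #|W|; elim: n W => // n IH W; rewrite ltnS => Wn hrW hK ltW.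
have hr : r = 2 \/ r = 3 by lia.
have [base|big] : ((r = 2 /\ #|W| = 8) \/ (r = 3 /\ #|W| = 9)) \/
    ((r = 2 /\ 8 < #|W|) \/ (r = 3 /\ 9 < #|W|)) by lia.
  exact: turan_coloring_base base hK ltW.
have [N WN] : exists N, #|W| = N.+1 by exists #|W|.-1; lia.
(* If every deletion fell below the extremal weight, [defect_le] with [a = 1] would fail at these
   sizes. *)
have [v vW ltv] : exists2 v, v \in W & extremal_weight N r <= weight G (W :\ v).
  apply/exists_inP; rewrite -[X in is_true X]negbK negb_exists_in.
  apply/negP => /forall_inP no_v.
  have := @defect_le T C G W N r 1 0 _ _ WN; rewrite addn0 -WN.
  have r0 : 0 < r by lia.
  have N0 : 0 < N by lia.
  have ub v : v \in W -> weight G (W :\ v) + 1 <= extremal_weight N r.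
    by move=> vW; rewrite addn1 ltnNge no_v.
  move=> /(_ r0 N0 ub ltW); rewrite muln1; clear no_v ub ltW hrW Wn N0.
  have [q [m [mr NE -> tE]]] := turan_cases N hr; rewrite {}WN in big *.
  move: tE big; move: (turan_num N r) => t tE big; subst N.
  by case: tE big => -[-> ->] big; move: m mr big => [|[|[|m]]] //=; nia.
set U := W :\ v; have WU : W = v |: U by rewrite setD1K.
have vU : v \notin U by rewrite !inE eqxx.
have UN : #|U| = N by have := cardsD1 v W; rewrite vW WN -/U; lia.
have [|||part [c0 TU]] := IH U _ _ hK.
- by rewrite UN; lia.
- by lia.
- by rewrite UN.
suff [part' TW] : exists part', turan_coloring G W r part' c0 by exists part', c0.
rewrite WU; apply: (turan_coloring_step _ _ _ hK TU vU); rewrite ?UN.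
- by lia.
- by case: big => -[-> big]; lia.
- by case: big => -[-> big]; lia.
(* As [U] does not exceed the extremal weight, the difference from [W] must come from the edges and
   colors at [v]. *)
rewrite -WU; have := weightD1 G vW; have := weight_le U hr hK; move: ltW.
by rewrite WN UN extremal_weightS -/U; lia.
Qed.

(** * From arbitrary colors to color classes *)

Lemma size_undup_map (A : eqType) (B C : eqType) (f : A -> B) (g : A -> C) s :
  {in s &, forall x y, (f x == f y) = (g x == g y)} ->
  size (undup (map f s)) = size (undup (map g s)).
Proof.
elim: s => //= x s IH fg; rewrite !(fun_if size) /= IH; last first.
  by move=> y z ys zs; apply: fg; rewrite inE ?ys ?zs orbT.
congr (if _ then _ else _); apply/mapP/mapP => -[y ys /eqP e]; exists y => //;
  by apply/eqP; move: e; rewrite fg // !inE ?eqxx ?ys ?orbT.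
Qed.

Lemma card_imset_undup (A : finType) (B : finType) (f : A -> B) (D : {set A}) :
  #|f @: D| = size (undup [seq f x | x in D]).
Proof.
rewrite -(card_uniqP (undup_uniq _)); apply: eq_card => y.
rewrite mem_undup; apply/imsetP/imageP => -[x xD ->]; by exists x.
Qed.

(* The color classes, which form a finite type, replace the colors. *)
Definition color_class (T : finType) (C : eqType) (G : ecgraph T C) (e : {set T}) :=
  [set e' in edges G | col G e' == col G e].

Definition class_graph (T : finType) (C : eqType) (G : ecgraph T C) :=
  ECGraph (graph G) (color_class G).

Section ClassGraph.
Variables (T : finType) (C : eqType) (G : ecgraph T C).

Lemma eq_color_class e e' : e \in edges G -> e' \in edges G ->
  (color_class G e == color_class G e') = (col G e == col G e').
Proof.
move=> eE e'E; apply/eqP/eqP => [cc|ce].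
  have : e \in color_class G e by rewrite inE eE eqxx.
  by rewrite cc inE => /andP[_ /eqP].
by apply/setP => e0; rewrite !inE ce.
Qed.

Lemma weight_class_graph :
  weight (class_graph G) [set: T] = num_edges G + num_colors G.
Proof.
have esubT : esub (class_graph G) [set: T] = edges G.
  by apply/setP => e; rewrite inE subsetT andbT.
rewrite /weight /csub esubT; congr (_ + _).
rewrite card_imset_undup; apply: size_undup_map => e e'.
by rewrite !mem_enum; apply: eq_color_class.
Qed.

Lemma class_graph_rainbow (U : finType) (H : sgraph U) (f : U -> T) :
  rainbow_copy H (class_graph G) f <-> rainbow_copy H G f.
Proof.
have img e : (forall u v, H u v -> G (f u) (f v)) -> e \in edges H ->
    f @: e \in edges G.
  move=> hom /edge_pair[u [v [uv _ ->]]].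
  by rewrite imsetU1 imset_set1 in_edges hom.
split=> -[f_inj hom inj]; split=> // e e' eH e'H /eqP ce; apply: inj => //;
  apply/eqP; move: ce; by rewrite /= eq_color_class // img.
Qed.

End ClassGraph.

(** Vertex [i] is sent to the entry of index [i %/ r] in the part labelled [i %% r]; equal sizes
    make this injection a bijection. *)
Lemma turan_embedding (T : finType) n r (part : T -> nat) :
    0 < r -> 0 < n -> #|T| = n ->
    (forall a, a < r -> #|[set x | part x == a]| = n %/ r + (a < n %% r)) ->
  exists f : 'I_n -> T, bijective f /\ forall i, part (f i) = turan_part r i.
Proof.
move=> r0 n0 cT part_card.
have /card_gt0P[x0 _] : 0 < #|T| by rewrite cT.
pose X a := enum [set x | part x == a].
have lt_size (i : 'I_n) : i %/ r < size (X (i %% r)).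
  rewrite /X -cardE part_card ?ltn_pmod //; have := ltn_ord i.
  have := divn_eq i r; have := divn_eq n r; have := ltn_pmod n r0.
  by move: (n %/ r) (n %% r) (i %/ r) (i %% r) => a b c d; case: ltnP; nia.
pose f (i : 'I_n) := nth x0 (X (i %% r)) (i %/ r).
have fP i : part (f i) = turan_part r i.
  have := mem_nth x0 (lt_size i).
  by rewrite -/(f i) /X mem_enum inE => /eqP.
exists f; split=> //; apply: inj_card_bij; last by rewrite card_ord cT.
move=> i j fij; have mE : i %% r = j %% r.
  by have := fP i; rewrite fij fP.
apply: val_inj; rewrite /= (divn_eq i r) (divn_eq j r) mE; congr (_ * _ + _).
have li := lt_size i; have lj := lt_size j.
move/eqP: fij; rewrite /f mE in li *.
by rewrite nth_uniq ?enum_uniq // => /eqP.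
Qed.

Theorem theorem4 (T : finType) (C : eqType) (G : ecgraph T C) (n k : nat)
    (cardT : #|T| = n)
    (hkn : (k = 4 /\ 8 <= n) \/ (k = 5 /\ 9 <= n))
    (hec : num_edges G + num_colors G = 'C(n, 2) + turan_num n (k - 2) + 1)
    (hK : ~ has_rainbow_K k G) :
  is_complete G /\
  exists f : 'I_n -> T,
    [/\ bijective f,
        rainbow_copy (turan n (k - 2)) G f &
        exists c0 : C,
          (forall i j : 'I_n, G (f i) (f j) ->
             turan_part (k - 2) i = turan_part (k - 2) j ->
             col G [set f i; f j] = c0) /\
          (forall i j : 'I_n, turan n (k - 2) i j ->
             col G [set f i; f j] <> c0)].
Proof.
have [r kE] : exists r, k = r.+2 by exists k.-2; lia.
move: hec; rewrite kE subSS subSS subn0 => hec.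
(* Since [C] need not be finite, the argument runs on color classes, with the same rainbow copies
   and number of colors. *)
have hK' : ~ has_rainbow_K r.+2 (class_graph G).
  by rewrite -kE => -[f /class_graph_rainbow fK]; apply: hK; exists f.
have hr : (r = 2 /\ 8 <= #|[set: T]|) \/ (r = 3 /\ 9 <= #|[set: T]|).
  by rewrite cardsT cardT; lia.
have [|part [c0 [part_lt part_card same_part diff_part]]] :=
    turan_coloring_exists hr hK'.
  by rewrite weight_class_graph hec cardsT cardT.
have adjG x y : x != y -> G x y.
  move=> xy; have [pxy|pxy] := eqVneq (part x) (part y).
    by case: (same_part x y (in_setT x) (in_setT y) xy pxy).
  by case: (diff_part x y (in_setT x) (in_setT y) pxy) => /link_adj[].
split; first exact: adjG.
have [|||f [f_bij fP]] := @turan_embedding T n r part _ _ cardT.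
- by lia.
- by lia.
- move=> a /part_card; rewrite cardsT cardT => <-; apply: eq_card => x.
  by rewrite !inE.
have f_inj := bij_inj f_bij.
have diff_f i j : turan n r i j -> part (f i) != part (f j).
  by rewrite !fP.
have rainbow_f : rainbow_copy (turan n r) (class_graph G) f.
  split=> // [i j /diff_f /diff_part[]|e e' eH e'H ce] //; first by case/link_adj.
  apply: (imset_inj f_inj).
  have [i [j [gij _ eE]]] := edge_pair eH.
  have [i' [j' [gij' _ e'E]]] := edge_pair e'H.
  subst e e'; rewrite !imsetU1 !imset_set1 in ce *.
  have [// | // | lij _] := diff_part _ _ _ _ (diff_f _ _ gij).
  apply/esym/(singleP lij) => //.
  have [// | // | lij' _] := diff_part _ _ _ _ (diff_f _ _ gij').
  exact: single_esub lij'.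
exists f; split=> //; first exact/class_graph_rainbow.
(* Vertices 0 and [r] lie in one part, so their edge supplies an actual color in [C] for the class
   [c0]. *)
have [n0 nr] : 0 < n /\ r < n by lia.
pose i0 := Ordinal n0; pose ir := Ordinal nr.
have cc0 i j : i != j -> turan_part r i = turan_part r j ->
    color_class G [set f i; f j] = c0.
  move=> ij pij; have fij : f i != f j by rewrite (inj_eq f_inj).
  by case: (same_part (f i) (f j)) => //; rewrite !fP.
have cE : color_class G [set f i0; f ir] = c0.
  apply: cc0; last by rewrite /turan_part /= mod0n modnn.
  by apply/eqP => /(congr1 val) /=; lia.
exists (col G [set f i0; f ir]); split=> [i j gij pij|i j tij ce].
  have ij : i != j by rewrite -(inj_eq f_inj); apply: adj_neq gij.
  have g0r : G (f i0) (f ir).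
    by apply: adjG; rewrite (inj_eq f_inj); apply/eqP => /(congr1 val) /=; lia.
  by apply/eqP; rewrite -eq_color_class ?in_edges // cE cc0.
have [// | // | _ /eqP[]] := diff_part _ _ _ _ (diff_f _ _ tij).
by rewrite -cE; apply/setP => e; rewrite !inE ce.
Qed.
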